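(* Let $G$ be a group with identity $e$, let $K$ be a field, let $m\geq 1$, and let the polynomial ring $R=K[x_1,x_2,\ldots,x_m]$ be equipped with a $G$-grading. If $R_e\subseteq K$, then $(R,G)$ is not weak.
   Context: A $G$-grading on a ring $R$ with unity is a decomposition $R=\bigoplus_{g\in G}R_g$ into additive subgroups $R_g$ with $R_gR_h\subseteq R_{gh}$ for all $g,h\in G$ (an arbitrary such grading is allowed; $K$ is not assumed to lie in $R_e$). $(R,G)$ is weak if for every $g\in G$, $R_g=\{0\}$ implies $R_{g^{-1}}=\{0\}$. *)

(* Defs.v *)
From HB Require Import structures.
From mathcomp Require Import all_boot all_algebra.
From mathcomp Require Import mpoly.

Set Implicit Arguments.
Unset Strict Implicit.
Unset Printing Implicit Defensive.

Import GRing.Theory.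

Local Open Scope ring_scope.

(* Components are Prop-valued subsets of [R], so that they are not required to
   be decidable; [G] may be infinite, so all sums run over finite duplicate-free
   lists of degrees.  The fields [grading_span] and [grading_direct] together
   say that [R] is the direct sum of the components. *)
Record is_grading (G : groupType) (R : pzRingType) (A : G -> R -> Prop) : Prop :=
  IsGrading {
    grading_0 : forall g, A g 0;
    grading_B : forall g x y, A g x -> A g y -> A g (x - y);
    grading_span : forall x, exists (s : seq G) (f : G -> R),
      [/\ uniq s, forall g, g \in s -> A g (f g) & x = \sum_(g <- s) f g];
    grading_direct : forall (s : seq G) (f : G -> R),
      uniq s -> (forall g, g \in s -> A g (f g)) -> \sum_(g <- s) f g = 0 ->
      forall g, g \in s -> f g = 0;
    grading_M : forall g h x y, A g x -> A h y -> A (g * h)%g (x * y)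
  }.

Definition weak_grading (G : groupType) (R : pzRingType) (A : G -> R -> Prop) :=
  forall g, (forall x, A g x <-> x = 0) -> (forall x, A g^-1%g x <-> x = 0).

(* Main.v *)
Require Import Defs.
From mathcomp Require Import all_boot all_algebra.
From mathcomp Require Import mpoly.

(** In the domain [K[x_1, ..., x_m]], nonzero [a] in [R_g] and [b] in [R_{g^-1}]
    have a nonzero product in [R_e], hence in [K], so [a] is a constant. If the
    grading is weak, every nonzero homogeneous element has such a partner, so
    all homogeneous elements, and with them all polynomials, are constant. *)

Import GRing.Theory.

Local Open Scope ring_scope.

(** [msize] is the total degree plus one, and degrees add over a domain, so nonzero factors of a
    constant have degree 0. *)
Lemma msize_le1_mul_const {K : idomainType} {m : nat} {p q : {mpoly K[m]}} {c : K} :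
  p != 0 -> q != 0 -> p * q = c%:MP -> (msize p <= 1)%N.
Proof.
move=> p0 q0 pq.
have := msizeM p0 q0; rewrite pq msizeC.
have := p0; have := q0; rewrite -!msize_poly_eq0.
by case: (msize p) (msize q) (c != 0) => [|[|k]] [|l] [] //; rewrite addnS.
Qed.

Lemma weak_homogeneous_msize_le1 {G : groupType} {K : idomainType} {m : nat}
    {A : G -> {mpoly K[m]} -> Prop} (hA : is_grading A)
    (hAe : forall p : {mpoly K[m]}, A 1%g p -> exists c : K, p = c%:MP)
    (hw : weak_grading A) {g : G} {a : {mpoly K[m]}} :
  A g a -> (msize a <= 1)%N.
Proof.
move=> Aa; apply/negPn/negP => a1.
have a0 : a != 0 by apply: contraNneq a1 => ->; rewrite msize0.
have Ag'0 b : A g^-1%g b <-> b = 0.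
  split=> [Ab | ->]; last exact: grading_0 hA _.
  apply/eqP/negPn/negP => b0.
  have := grading_M hA Aa Ab; rewrite mulgV => /hAe [c abc].
  by rewrite (msize_le1_mul_const a0 b0 abc) in a1.
(* Weakness is applied at [g^-1], whose component was just shown to vanish; hence so does that of
   [g], against [a != 0]. *)
have := hw _ Ag'0 a; rewrite invgK => -[/(_ Aa) /eqP].
by rewrite (negPf a0).
Qed.

Theorem proposition2p24 (G : groupType) (K : fieldType) (m : nat)
    (hm : (1 <= m)%N) (A : G -> {mpoly K[m]} -> Prop) (hA : is_grading A)
    (hAe : forall p : {mpoly K[m]}, A 1%g p -> exists c : K, p = c%:MP) :
  ~ weak_grading A.
Proof.
move=> hw; pose i := Ordinal hm.
(* Compare coefficients of the variable ['X_i]: it is 1 on the left, while constant homogeneous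
   summands all contribute 0. *)
have [s [f [_ Af /(congr1 (mcoeff U_(i)))]]] := grading_span hA 'X_i.
rewrite mcoeffXU eqxx raddf_sum big_seq big1 => [/eqP|g sg /=].
  by rewrite oner_eq0.
have /msize1_polyC -> := weak_homogeneous_msize_le1 hA hAe hw (Af g sg).
by rewrite mcoeffC mnm1_eq0 mulr0.
Qed.
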